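(* Let $\Gamma$ be an infinite set. The following statements are equivalent: (i) $|\Gamma|$ is a Kunen cardinal. (ii) $\mathrm{Ba}(C_p(2^\Gamma)) = \mathrm{Bo}(C(2^\Gamma))$. (iii) $\mathrm{Ba}(C_p(2^\Gamma,2)) = \mathcal{P}(C(2^\Gamma,2))$. (iv) The $\sigma$-algebra on $\mathrm{Clop}(2^\Gamma)$ generated by all ultrafilters (i.e. by the family of all ultrafilters of the Boolean algebra $\mathrm{Clop}(2^\Gamma)$, each regarded as a subset of $\mathrm{Clop}(2^\Gamma)$) is $\mathcal{P}(\mathrm{Clop}(2^\Gamma))$.
   Context: $\mathcal{P}(S)$ is the power set of $S$. A cardinal $\kappa$ is a Kunen cardinal if $\mathcal{P}(\kappa\times\kappa)=\mathcal{P}(\kappa)\otimes\mathcal{P}(\kappa)$, i.e. the power set of $\kappa\times\kappa$ coincides with the $\sigma$-algebra on $\kappa\times\kappa$ generated by all products $A\times B$ with $A,B\subset\kappa$. $2^\Gamma$ is the Cantor cube $\{0,1\}^\Gamma$ with the pointwise convergence (product) topology, and $C(2^\Gamma)$ is the Banach space of all continuous real-valued functions on $2^\Gamma$ with the supremum norm. $C_p(2^\Gamma)$ is $C(2^\Gamma)$ equipped with the pointwise convergence topology. For a topological space $T$, $\mathrm{Bo}(T)$ is the Borel $\sigma$-algebra generated by the open sets, and $\mathrm{Ba}(T)$ is the Baire $\sigma$-algebra generated by all continuous real-valued functions on $T$. It is well known that, for $K$ compact Hausdorff, $\mathrm{Ba}(C_p(K))$ is the $\sigma$-algebra generated by the evaluations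 $\delta_t$, $t\in K$. $\mathrm{Bo}(C(2^\Gamma))$ refers to the norm topology. $C(2^\Gamma,2)$ is the subset of $C(2^\Gamma)$ of all $\{0,1\}$-valued functions. $\mathrm{Ba}(C_p(2^\Gamma,2))$ denotes the trace of $\mathrm{Ba}(C_p(2^\Gamma))$ on $C(2^\Gamma,2)$, i.e. $\{C(2^\Gamma,2)\cap A: A\in \mathrm{Ba}(C_p(2^\Gamma))\}$. $\mathrm{Clop}(2^\Gamma)$ is the Boolean algebra of all clopen subsets of $2^\Gamma$. *)

(* Defs.v *)
From HB Require Import structures.
From mathcomp Require Import all_boot all_order all_algebra.
From mathcomp Require Import all_classical all_reals all_analysis.

Set Implicit Arguments.
Unset Strict Implicit.
Unset Printing Implicit Defensive.

Import Order.TTheory GRing.Theory Num.Theory.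
Import numFieldNormedType.Exports.

Local Open Scope classical_set_scope.
Local Open Scope ring_scope.

(* Stated for a set rather than for a cardinal number: the property is
   invariant under bijections, so it says that |T| is a Kunen cardinal. *)
Definition kunen_cardinal (T : Type) : Prop :=
  <<s [set A `*` B | A in [set: set T] & B in [set: set T]] >>
  = [set: set (T * T)].

Definition borel_algebra (T : topologicalType) : set (set T) :=
  <<s @open T >>.
Arguments borel_algebra : clear implicits.

Definition baire_algebra (R : realType) (T : topologicalType) : set (set T) :=
  <<s [set f @^-1` B | f in [set f : T -> R | continuous f]
                     & B in (@measurable _ R : set (set R))] >>.
Arguments baire_algebra : clear implicits.

Definition cantor_cube (G : Type) : topologicalType := {ptws G -> bool}.

Section ContinuousFunctions.
Variables (R : realType) (K : topologicalType).

(* [C_norm] and [C_ptws] below are two names for the same carrier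
   [continuousType K R], with two different topologies. *)

(* [sup] is the true supremum because the function is bounded when [K] is
   compact, the only case of interest here. *)
Definition sup_norm (f : K -> R) : R := sup [set `|f x| | x in [set: K]].

Definition C_norm : Type := continuousType K R.

HB.instance Definition _ := Choice.on C_norm.

Definition norm_open (U : set C_norm) : Prop :=
  forall f, U f -> exists2 e : R, 0 < e &
    forall g : C_norm, sup_norm (fun x => g x - f x) < e -> U g.

Lemma norm_openT : norm_open [set: C_norm].
Proof. by move=> f _; exists 1. Qed.

Lemma norm_openI : setI_closed norm_open.
Proof.
move=> U V oU oV f [/oU[d d0 dU] /oV[e e0 eV]].
exists (Num.min d e); first by rewrite lt_min d0 e0.
by move=> g; rewrite lt_min => /andP[/dU ? /eV].
Qed.

Lemma norm_open_bigU (I : Type) (U : I -> set C_norm) :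
  (forall i, norm_open (U i)) -> norm_open (\bigcup_i U i).
Proof.
move=> oU f [i _ /oU[e e0 eU]]; exists e => // g /eU Ug; by exists i.
Qed.

HB.instance Definition _ :=
  isOpenTopological.Build C_norm norm_openT norm_openI norm_open_bigU.

Definition C_ptws : topologicalType :=
  initial_topology (fun f : continuousType K R => (f : {ptws K -> R})).

Definition C_two : set (continuousType K R) :=
  [set f | forall x, f x = 0 \/ f x = 1].

End ContinuousFunctions.
Arguments C_two : clear implicits.

Section BooleanAlgebraOfSets.
Variables (X : Type) (B : set (set X)).

(* [B] is meant to be a Boolean algebra of subsets of [X], with the usual set
   operations. *)
Definition ba_proper_filter (F : set (set X)) : Prop :=
  [/\ F `<=` B,
      F setT,
      ~ F set0,
      (forall P Q, F P -> F Q -> F (P `&` Q))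
    & (forall P Q, F P -> B Q -> P `<=` Q -> F Q)].

Definition ba_ultrafilter (F : set (set X)) : Prop :=
  ba_proper_filter F /\
  forall F', ba_proper_filter F' -> F `<=` F' -> F' = F.

End BooleanAlgebraOfSets.

(* Main.v *)
Require Import Defs.
From HB Require Import structures.
From mathcomp Require Import all_boot all_order all_algebra.
From mathcomp Require Import all_classical all_reals all_analysis.

Import Order.TTheory GRing.Theory Num.Theory.
Import numFieldNormedType.Exports.

(** (i) => (ii). The diagonal of [G * G] lies in the product sigma-algebra, so
    countably many sets separate the points of [G]; hence all powers of 2 indexed
    by subsets of [G] are separable, and "f varies by at most e when only the
    coordinates in A change" is a Baire condition on f for every subset A of [G].
    By uniform continuity f depends up to e on finitely many coordinates, each of
    which is isolated from the others by one of the countably many atoms. This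
    turns the essential coordinates of f into maps to [(G, P(G))] that are
    measurable for the Baire sigma-algebra. As [G * G] embeds into [G], the Kunen
    property makes finite tuples of such maps measurable for the full power set,
    and a norm-open set is a countable union of conditions on the tuple of
    essential coordinates and on a rational table of values.

    (ii) => (iii). The {0,1}-valued functions are at mutual distance 1, so each
    of their subsets is the trace of a norm-open set.

    (iii) => (iv). By the countable chain condition, disjoint pointwise open sets
    of clopen sets are separated by a set depending on countably many points;
    hence the trace on Clop of any Baire set belongs to the sigma-algebra
    generated by the point ultrafilters.

    (iv) => (i). Pull back along (a, b) |-> {x | x a = 1, x b = 0}, which is
    injective off the diagonal and turns ultrafilters into rectangles. *)

Set Implicit Arguments.
Unset Strict Implicit.
Unset Printing Implicit Defensive.

Local Open Scope classical_set_scope.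
Local Open Scope ring_scope.

(** * Sigma-algebras and the Kunen property *)

Section SigmaAlgebra.
Context (T : Type) (D : set T) (S : set (set T)).
Hypothesis sS : sigma_algebra D S.

Lemma sigma_bigcup (I : countType) (F : I -> set T) :
  (forall i, S (F i)) -> S (\bigcup_i F i).
Proof.
case: sS => S0 _ SU SF.
rewrite (_ : \bigcup_i F i = \bigcup_n oapp F set0 (unpickle n)).
  by apply: SU => n; case: unpickle => //=.
apply/seteqP; split=> x [i _ Fx]; first by exists (pickle i); rewrite ?pickleK.
by move: Fx; case: (unpickle i) => [j|] //= Fx; exists j.
Qed.

Lemma sigma_setU A B : S A -> S B -> S (A `|` B).
Proof.
move=> SA SB; rewrite (_ : A `|` B = \bigcup_(b : bool) if b then A else B).
  by apply: sigma_bigcup => -[].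
apply/seteqP; split=> x; first by case=> ?; [exists true|exists false].
by case=> -[] _ /= ?; [left|right].
Qed.

End SigmaAlgebra.

Section SigmaAlgebraT.
Context (T : Type) (S : set (set T)).
Hypothesis sS : sigma_algebra setT S.

Lemma sigma_setC A : S A -> S (~` A).
Proof. by case: sS => _ + _ => /[apply]; rewrite setTD. Qed.

Lemma sigma_bigcap (I : countType) (F : I -> set T) :
  (forall i, S (F i)) -> S (\bigcap_i F i).
Proof.
move=> SF; rewrite -[X in S X]setCK setC_bigcap; apply: sigma_setC.
by apply: (sigma_bigcup sS) => i; exact: sigma_setC.
Qed.

Lemma sigma_setI A B : S A -> S B -> S (A `&` B).
Proof.
move=> SA SB; rewrite -[X in S X]setCK setCI; apply: sigma_setC.
by apply: (sigma_setU sS); exact: sigma_setC.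
Qed.

Lemma sigma_cst (P : Prop) : S [set _ | P].
Proof.
have [p|np] := pselect P.
  rewrite (_ : [set _ | P] = ~` set0); first by apply: sigma_setC; case: sS.
  by rewrite setC0; apply/seteqP; split.
rewrite (_ : [set _ | P] = set0); first by case: sS.
by apply/seteqP; split.
Qed.

End SigmaAlgebraT.

Section Kunen.
Context (G : Type).

Definition sigma_map (T : Type) (S : set (set T)) (t : T -> G) : Prop :=
  forall A : set G, S (t @^-1` A).

Hypothesis kG : kunen_cardinal G.

Lemma kunen_ind (S : set (set (G * G))) :
  sigma_algebra setT S -> (forall A B, S (A `*` B)) -> forall E, S E.
Proof.
move=> sS SX E.
have : [set: set (G * G)] E by [].
rewrite -kG; apply: smallest_sub => // _ [A _ [B _ <-]]; exact: SX.
Qed.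

(* Every subset of [G * G] is generated by countably many rectangles, so it
   only sees countably many subsets of [G]; apply this to the diagonal. *)
Lemma kunen_separating : exists C : nat -> G -> bool,
  forall a b, (forall k, C k a = C k b) -> a = b.
Proof.
pose S : set (set (G * G)) := [set E | exists C : nat -> G -> bool,
  forall a a' b b', (forall k, C k a = C k a') -> (forall k, C k b = C k b') ->
    E (a, b) -> E (a', b')].
have sS : sigma_algebra setT S.
  split.
  - by exists (fun _ _ => false).
  - move=> A [C CA]; exists C => a a' b b' Ca Cb [_ nA]; split=> // A'; apply: nA.
    exact: CA A'.
  - move=> A /choice[C CA].
    exists (fun k => if @unpickle (nat * nat)%type k is Some (n, m)
                     then C n m else fun=> false).
    move=> a a' b b' Ca Cb [n _ An]; exists n => //; apply: CA An => m.
      by have := Ca (pickle (n, m)); rewrite pickleK.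
    by have := Cb (pickle (n, m)); rewrite pickleK.
have SX A B : S (A `*` B).
  exists (fun k x => if k is 0%N then `[<A x>] else `[<B x>]).
  move=> a a' b b' Ca Cb [/= Aa Bb]; split=> /=.
    by apply/asboolP; rewrite -(Ca 0%N); exact/asboolP.
  by apply/asboolP; rewrite -(Cb 1%N); exact/asboolP.
have [C CP] := kunen_ind sS SX [set p | p.1 = p.2].
(* Moving only the second entry of [(a, a)] to [b] does not leave the diagonal. *)
by exists C => a b Cab; apply: (CP a a a b).
Qed.

Context (T : Type) (S : set (set T)).
Hypothesis sS : sigma_algebra setT S.

(** The sets [E] with preimage in [S] form a sigma-algebra containing the rectangles; by the Kunen
    property it is everything. *)
Lemma sigma_map_pair t u : sigma_map S t -> sigma_map S u ->
  forall E : set (G * G), S [set x | E (t x, u x)].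
Proof.
move=> mt mu; apply: kunen_ind => [|A B]; last exact: (sigma_setI sS (mt A) (mu B)).
split.
- by case: sS.
- by move=> A SA; rewrite setTD; exact: sigma_setC SA.
- move=> A SA.
  rewrite (_ : [set x | _] = \bigcup_i [set x | A i (t x, u x)]).
    by case: sS => _ _; apply.
  by apply/seteqP; split=> x [i _ Ai]; exists i.
Qed.

Hypothesis Ginf : exists h : G * G -> G, injective h.

(** The injection [h] folds the tuple into one measurable map [u] that determines it, so any
    condition on the tuple is a condition on [u]. *)
Lemma sigma_map_seq (g0 : G) (I : Type) (r : seq I) (t : I -> T -> G) :
  (forall i, sigma_map S (t i)) ->
  forall X : set (seq G), S [set x | X [seq t i x | i <- r]].
Proof.
move=> mt X; have [h hI] := Ginf.
have [u mu uP] : exists2 u, sigma_map S u &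
    forall x y, u x = u y -> [seq t i x | i <- r] = [seq t i y | i <- r].
  elim: r => [|i r [u mu uP]]; first by exists (fun=> g0) => // A; exact: sigma_cst.
  exists (fun x => h (t i x, u x)) => [A|x y /hI[tE /uP rE]]; last first.
    by rewrite /= tE rE.
  exact: (sigma_map_pair (mt i) mu (h @^-1` A)).
rewrite (_ : [set x | _] = u @^-1` (u @` [set x | X [seq t i x | i <- r]])) //.
apply/seteqP; split=> x /=; first by exists x.
by move=> [y Xy /uP <-].
Qed.

End Kunen.

(** * An infinite set absorbs its square *)

Section Pairing.

Definition inj_graph (X Y : Type) (f : set (X * Y)) : Prop :=
  forall p q, f p -> f q -> (p.1 = q.1 <-> p.2 = q.2).

Lemma inj_graph_bigcup (X Y : Type) (F : set (set (X * Y))) :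
  (forall f, F f -> inj_graph f) -> total_on F subset ->
  inj_graph (\bigcup_(f in F) f).
Proof.
move=> Fi Ft p q [f Ff fp] [g Fg gq].
have [fg|gf] := Ft _ _ Ff Fg.
  by apply: (Fi g) => //; exact: fg.
by apply: (Fi f) => //; exact: gf.
Qed.

Variables (G : Type).

Definition inj_into (A B : set G) (u : G -> G) : Prop :=
  (forall a, A a -> B (u a)) /\
  (forall a b, A a -> A b -> u a = u b -> a = b).

(** Comparability of cardinals: a maximal partial injection from [A] to [B] has full domain or full
    range, else one more pair could be added. *)
Lemma inj_into_total (A B : set G) :
  (exists u, inj_into A B u) \/ (exists u, inj_into B A u).
Proof.
pose P (f : set (G * G)) := f `<=` A `*` B /\ inj_graph f.
have [F FP Ft|f [[fAB fi] fmax]] := @Zorn_bigcup _ P.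
  split; first by move=> p [f Ff fp]; exact: (FP _ Ff).1.
  by apply: inj_graph_bigcup => // f Ff; exact: (FP _ Ff).2.
have [fA|/existsNP[a /not_implyP[Aa na]]] :=
    pselect (forall a, A a -> exists b, f (a, b)).
  left; have /choice[u uP] : forall a, exists b, A a -> f (a, b).
    move=> a; have [Aa|nA] := pselect (A a); last by exists a.
    by have [b ab] := fA _ Aa; exists b.
  exists u; split=> [a Aa|a b Aa Ab uab]; first by have [] := fAB _ (uP _ Aa).
  by have /= -> := fi _ _ (uP _ Aa) (uP _ Ab).
have [fB|/existsNP[b /not_implyP[Bb nb]]] :=
    pselect (forall b, B b -> exists a, f (a, b)).
  right; have /choice[u uP] : forall b, exists a, B b -> f (a, b).
    move=> b; have [Bb|nB] := pselect (B b); last by exists b.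
    by have [c ab] := fB _ Bb; exists c.
  exists u; split=> [c Ac|c d Ac Ad uab]; first by have [] := fAB _ (uP _ Ac).
  by have /= <- := fi _ _ (uP _ Ac) (uP _ Ad).
exfalso; apply: (fmax (f `|` [set (a, b)])).
  split; first by left.
  by move=> /(_ (a, b) (or_intror erefl)) ab; apply: na; exists b.
split; first by move=> p [/fAB//|->].
move=> [c d] [c' d'] [fp|[-> ->]] [fq|[-> ->]] //=; first exact: fi fp fq.
  by split=> E; subst; exfalso; [apply: na; exists d|apply: nb; exists c].
by split=> E; subst; exfalso; [apply: na; exists d'|apply: nb; exists c'].
Qed.

(** If [f] is the graph of a map [A * A -> A], this recovers [A]; so [square f] says that [f] is an
    injection of the square of [diag f] into [diag f]. *)
Let diag (f : set (G * G * G)) : set G := [set a | exists y, f (a, a, y)].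

Let square (f : set (G * G * G)) : Prop :=
  [/\ inj_graph f,
      forall a b, diag f a -> diag f b -> exists y, f (a, b, y)
    & forall a b y, f (a, b, y) -> [/\ diag f a, diag f b & diag f y]].

(* Zorn's lemma on injections [A * A -> A] with [A] infinite: a maximal one has
   an [A] whose complement injects into [A]. *)
Lemma infinite_pairing : infinite_set [set: G] -> exists h : G * G -> G, injective h.
Proof.
move=> /infiniteP/card_leP/unsquash e0.
pose e i : G := val (e0 (to_setT i)).
have eI : injective e.
  by move=> i j /val_inj /inj; rewrite !inE => /(_ I I) /(congr1 val).
pose f0 : set (G * G * G) :=
  [set p | exists i j, p = (e i, e j, e (pickle (i, j)))].
have f0sq : square f0.
  have d0 i : diag f0 (e i) by exists (e (pickle (i, i))), i, i.
  split.
  - move=> _ _ [i [j ->]] [i' [j' ->]] /=; split; first by move=> [/eI -> /eI ->].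
    by move=> /eI /(pcan_inj pickleK) [-> ->].
  - move=> a b [y [i [j [-> _ _]]]] [y' [i' [j' [-> _ _]]]].
    by exists (e (pickle (i, i'))), i, i'.
  - by move=> a b y [i [j [-> -> ->]]].
(* The union of the empty chain is empty, so [f0] cannot be required outright; a maximal [f] still
   contains it, since an empty [f] is extended by [f0]. *)
pose P f := square f /\ (f !=set0 -> f0 `<=` f).
have [F FP Ft|f [[fsq f0f] fmax]] := @Zorn_bigcup _ P.
  split; last first.
    move=> [p [f Ff fp]] q /(FP _ Ff).2 fq; exists f => //.
    by apply: fq; exists p.
  split.
  - by apply: inj_graph_bigcup => // f Ff; have [[]] := FP _ Ff.
  - move=> a b [y [f Ff fy]] [z [g Fg gz]].
    have [fg|gf] := Ft _ _ Ff Fg.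
      have [[_ + _] _] := FP _ Fg => /(_ a b) []; last by move=> x ?; exists x, g.
        by exists y; exact: fg.
      by exists z.
    have [[_ + _] _] := FP _ Ff => /(_ a b) []; last by move=> x ?; exists x, f.
      by exists y.
    by exists z; exact: gf.
  - move=> a b y [f Ff fy]; have [[_ _ /(_ _ _ _ fy)]] := FP _ Ff.
    by move=> [[u ?] [v ?] [w ?]] _; split; [exists u, f|exists v, f|exists w, f].
have {}f0f : f0 `<=` f.
  apply: contrapT => nf; apply: (fmax f0); last by split=> // _ p.
  by split=> // p fp; exfalso; apply: nf; apply: f0f; exists p.
have [fi fT fR] := fsq.
pose A := diag f.
have Ae i : A (e i) by exists (e (pickle (i, i))); apply: f0f; exists i, i.
have /choice[m mP] : forall p : G * G, exists y, A p.1 -> A p.2 -> f (p, y).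
  move=> [a b] /=; have [[Aa Ab]|nA] := pselect (A a /\ A b).
    by have [y fy] := fT _ _ Aa Ab; exists y.
  by exists a => Aa Ab; case: nA.
have mA a b : A a -> A b -> A (m (a, b)).
  by move=> Aa Ab; have [] := fR _ _ _ (mP (a, b) Aa Ab).
have mI a b a' b' : A a -> A b -> A a' -> A b' ->
    m (a, b) = m (a', b') -> a = a' /\ b = b'.
  move=> Aa Ab Aa' Ab' E.
  by have /= [_ /(_ E) []] := fi _ _ (mP (a, b) Aa Ab) (mP (a', b') Aa' Ab').
(* [e 0] and [e 1] tag the elements of [A] and those of [B] outside [A]; [m] packs the tag with an
   element of [A]. *)
have pair_of (B : set G) (u : G -> G) : inj_into B A u -> exists v, inj_into (A `|` B) A v.
  move=> [uA uI]; exists (fun x => if pselect (A x) then m (e 0%N, x) else m (e 1%N, u x)).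
  split=> [a|a b].
    by case: pselect => [Aa _|nA [//|Ba]]; apply: mA => //; exact: uA.
  have e01 : e 0%N <> e 1%N by move=> /eI.
  case: pselect => [Aa _|nA [//|Ba]]; case: pselect => [Ab _|nA' [//|Bb]].
  - by move=> /mI -[].
  - by move=> /mI -[] //; exact: uA.
  - by move=> /mI -[] //; [exact: uA|move=> /esym].
  - by move=> /mI -[] //; [exact: uA|exact: uA|move=> _; exact: uI].
(* If the complement of [A] embeds in [A], so does all of [G], and [m] gives the pairing. In the
   other case [A] embeds in its complement and [f] can be extended. *)
have [[u [uA uI]]|[u uAC]] := inj_into_total A (~` A); last first.
  have [v [vA vI]] := pair_of _ _ uAC.
  have {}vA x : A (v x) by apply: vA; rewrite setUv.
  have {}vI x y : v x = v y -> x = y by apply: vI; rewrite setUv.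
  exists (fun p => m (v p.1, v p.2)) => -[a b] [a' b'] /= /mI.
  by move=> [] // /vI -> /vI ->.
exfalso; pose B := u @` A.
have AB x : A x -> ~ B x by move=> Ax [y Ay yx]; apply: (uA _ Ay); rewrite yx.
have [w wBA] : exists w, inj_into B A w.
  have /choice[w wP] : forall b, exists a, B b -> A a /\ u a = b.
    move=> b; have [[a Aa ab]|nB] := pselect (B b); first by exists a.
    by exists b.
  exists w; split=> [b Bb|b b' Bb Bb' E]; first by case: (wP _ Bb).
  by rewrite -(wP _ Bb).2 E (wP _ Bb').2.
have [v [vA vI]] := pair_of _ _ wBA.
(* The new pairs take values in the copy [B] of [A], so they never collide with the old values,
   which lie in [A]. *)
pose f' := f `|` [set p | [/\ (A `|` B) p.1.1, (A `|` B) p.1.2,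
  ~ (A p.1.1 /\ A p.1.2) & p.2 = u (m (v p.1.1, v p.1.2))]].
have ff' : f `<=` f' by left.
have AD a : A a -> diag f' a by move=> [y fy]; exists y; left.
have BD a : B a -> diag f' a.
  move=> Ba; exists (u (m (v a, v a))); right; split=> //=; [by right|by right|].
  by move=> [/AB].
have ABD a : (A `|` B) a -> diag f' a by case; [exact: AD|exact: BD].
have DAB a : diag f' a -> (A `|` B) a.
  by move=> [y [fy|[]//]]; left; exists y.
have Bu p : (A `|` B) p.1 -> (A `|` B) p.2 -> B (u (m (v p.1, v p.2))).
  by move=> p1 p2; exists (m (v p.1, v p.2)) => //; apply: mA; exact: vA.
apply: (fmax f').
  split=> // f'f; have Be : B (u (e 0%N)) by exists (e 0%N).
  have [z /f'f fz] := BD _ Be.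
  by apply: (uA _ (Ae 0%N)); have [] := fR _ _ _ fz.
split; last by move=> _; exact: subset_trans ff'.
split.
- move=> [[a b] y] [[a' b'] y'] [fp|[/= Da Db nab yE]] [fq|[/= Da' Db' nab' yE']] /=.
  + exact: fi fp fq.
  + have [Aa Ab Ay] := fR _ _ _ fp; split; first by case=> *; subst; case: nab'.
    by move=> E; exfalso; apply: (AB _ Ay); rewrite E yE'; exact: (Bu (a', b')).
  + have [Aa Ab Ay] := fR _ _ _ fq; split; first by case=> *; subst; case: nab.
    by move=> E; exfalso; apply: (AB _ Ay); rewrite -E yE; exact: (Bu (a, b)).
  + rewrite yE yE'; split; first by case=> -> ->.
    move=> /uI; move=> /(_ (mA _ _ (vA _ Da) (vA _ Db)) (mA _ _ (vA _ Da') (vA _ Db'))).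
    move=> /mI [] //; try exact: vA.
    by move=> /vI -> // /vI ->.
- move=> a b /DAB Da /DAB Db; have [[Aa Ab]|nab] := pselect (A a /\ A b).
    by exists (m (a, b)); left; exact: mP.
  by exists (u (m (v a, v b))); right.
- move=> a b y [fy|[/= Da Db _ ->]].
    by have [Aa Ab Ay] := fR _ _ _ fy; split; exact: AD.
  by split; [exact: ABD|exact: ABD|apply: BD; exact: (Bu (a, b))].
Qed.

End Pairing.

(** * Oscillation along sets of coordinates *)

Section Patterns.
Context (G : eqType) (C : nat -> G -> bool).
Hypothesis C_sep : forall a b, (forall k, C k a = C k b) -> a = b.

Definition pat n (a : G) : bitseq := mkseq (C ^~ a) n.

Lemma eq_patW m n a b : (m <= n)%N -> pat n a = pat n b -> pat m a = pat m b.
Proof.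
have takeE c : (m <= n)%N -> pat m c = take m (pat n c).
  by move=> mn; rewrite /pat /mkseq -map_take take_iota (minn_idPl mn).
by move=> mn E; rewrite !takeE // E.
Qed.

Lemma pat_separates (F : seq G) : exists n, forall a b,
  a \in F -> b \in F -> pat n a = pat n b -> a = b.
Proof.
have /choice[N NP] : forall p : G * G, exists n, pat n p.1 = pat n p.2 -> p.1 = p.2.
  move=> [a b] /=; have [->|ab] := eqVneq a b; first by exists 0%N.
  have [k Ck] : exists k, C k a <> C k b.
    by apply/existsNP => /C_sep /eqP; rewrite (negPf ab).
  exists k.+1 => /(congr1 (nth false ^~ k)).
  by rewrite !nth_mkseq.
exists (\max_(p <- [seq (a, b) | a <- F, b <- F]) N p)%N => a b aF bF /eq_patW E.
apply: (NP (a, b)); apply: E; apply: leq_bigmax_seq => //.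
by apply/allpairsP; exists (a, b).
Qed.

(* The functions [G -> bool] depending on finitely many of the sets [C k]. *)
Definition dense_pt (i : nat * seq bitseq) (a : G) : bool := pat i.1 a \in i.2.

(** At a level that separates [F], each point of [F] has a pattern of its own, so any values on [F]
    can be prescribed. *)
Lemma dense_ptP (F : seq G) (x : G -> bool) :
  exists i, forall a, a \in F -> dense_pt i a = x a.
Proof.
have [n nP] := pat_separates F.
exists (n, [seq pat n a | a <- F & x a]) => a aF; rewrite /dense_pt /=.
apply/mapP/idP => [[b]|xa].
  by rewrite mem_filter => /andP[xb bF] /nP -> //.
by exists a => //; rewrite mem_filter xa.
Qed.

End Patterns.

Section Oscillation.
Context (R : realType) (G : choiceType).
Implicit Types (f : (G -> bool) -> R) (A B P : set G) (e : R) (F : seq G).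

Definition osc_le f A e : Prop := forall x y : G -> bool,
  (forall a, ~ A a -> x a = y a) -> `|f x - f y| <= e.

(** Uniform continuity for the product uniformity, in terms of coordinates. *)
Definition finitary f : Prop :=
  forall e, 0 < e -> exists F, osc_le f [set a | a \notin F] e.

Lemma osc_leS f A B e : A `<=` B -> osc_le f B e -> osc_le f A e.
Proof. by move=> AB fB x y xy; apply: fB => a nB; apply: xy => /AB. Qed.

Lemma osc_leU f A B e e' :
  osc_le f A e -> osc_le f B e' -> osc_le f (A `|` B) (e + e').
Proof.
move=> fA fB x y xy; pose z a := if pselect (A a) then y a else x a.
rewrite -(subrKA (f z)); apply: (le_trans (ler_normD _ _)); apply: lerD.
  by apply: fA => a nA; rewrite /z; case: pselect.
apply: fB => a nB; rewrite /z; case: pselect => // nA.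
by apply: xy => -[].
Qed.

Lemma osc_le_closed f A e :
  (forall d, 0 < d -> osc_le f A (e + d)) -> osc_le f A e.
Proof.
move=> fA x y xy; apply/ler_addgt0Pr => d d0; exact: fA.
Qed.

Lemma osc_le_agree f F e x y : osc_le f [set a | a \notin F] e ->
  (forall a, a \in F -> x a = y a) -> `|f x - f y| <= e.
Proof. by move=> fF xy; apply: fF => a /negP; rewrite negbK; exact: xy. Qed.

Context (C : nat -> G -> bool).
Hypothesis C_sep : forall a b, (forall k, C k a = C k b) -> a = b.

(** Up to an error [d], both points may be replaced by dense points agreeing with them on a finite
    set; splicing along [A] keeps the pair equal off [A]. So countably many evaluations decide
    [osc_le], whatever the size of [A]. *)
Lemma osc_le_dense f A e : finitary f -> osc_le f A e <->
  forall i j, `|f (dense_pt C i) -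
    f (fun a => if pselect (A a) then dense_pt C j a else dense_pt C i a)| <= e.
Proof.
move=> ff; split=> [fA i j|fA].
  by apply: fA => a nA; case: pselect.
apply: osc_le_closed => d d0 x y xy.
have [F fF] := ff (d / 2) (divr_gt0 d0 (ltr0Sn R 1)).
have [i iP] := dense_ptP C_sep F x; have [j jP] := dense_ptP C_sep F y.
have {fA} := fA i j; set z := (X in _ - f X) => fA.
have xi : `|f x - f (dense_pt C i)| <= d / 2.
  by apply: osc_le_agree fF _ => a /iP.
have yz : `|f z - f y| <= d / 2.
  apply: osc_le_agree fF _ => a aF; rewrite /z; case: pselect => [Aa|nA] /=; first exact: jP.
  by rewrite iP //; exact: xy.
rewrite -(subrKA (f (dense_pt C i))) -[X in _ + X](subrKA (f z)).
apply: (le_trans (ler_normD _ _)); rewrite (_ : e + d = d / 2 + (e + d / 2)); last by rewrite addrCA -splitr.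
apply: lerD => //.
by apply: (le_trans (ler_normD _ _)); exact: lerD.
Qed.

(* One coordinate of [P] dominates all the others together. *)
Definition concentrated f P e : Prop :=
  ~ osc_le f P (e + e) /\ exists2 a, P a & osc_le f (P `\ a) e.

(** Were [a] outside [A], the sets [P \ a] and [P \ A], both of oscillation at most [e], would cover
    [P]. One oscillation condition thus locates the dominating coordinate. *)
Lemma concentrated_at f P e a A : ~ osc_le f P (e + e) ->
  osc_le f (P `\ a) e -> A a <-> osc_le f (P `\` A) e.
Proof.
move=> nP fa; split=> [Aa|fA].
  by apply: osc_leS fa => b [Pb nA]; split=> // /= ba; apply: nA; rewrite ba.
apply: contrapT => nA; apply: nP; apply: osc_leS (osc_leU fa fA) => b Pb.
have [Ab|nAb] := pselect (A b); last by right.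
by left; split=> // ba; apply: nA; rewrite -ba.
Qed.

(* Only countably many sets occur on the right-hand side; [a] is found in a
   finite set off which [f] oscillates by at most [e]. *)
Lemma concentratedP f P e : finitary f -> 0 < e -> concentrated f P e <->
  ~ osc_le f P (e + e) /\
  forall n, exists s, osc_le f (P `&` [set a | pat C n a <> s]) e.
Proof.
move=> ff e0; split=> -[nP].
  move=> [a Pa fa]; split=> // n; exists (pat C n a).
  by apply: osc_leS fa => b [Pb /= nb]; split=> // ba; apply: nb; rewrite ba.
move=> fs; split=> //; have [F fF] := ff e e0.
have [a Pa fa] : exists2 a, P a &
    forall n, osc_le f (P `&` [set b | pat C n b <> pat C n a]) e.
  apply: contrapT => na.
  have /choice[N NP] : forall a, exists n, P a ->
      ~ osc_le f (P `&` [set b | pat C n b <> pat C n a]) e.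
    move=> a; have [Pa|nPa] := pselect (P a); last by exists 0%N.
    apply: contrapT => H; apply: na; exists a => // n; apply: contrapT => H'.
    by apply: H; exists n.
  (* One level serves all of [F]: the cell [s] found there contains no point of [P] in [F], so [P]
     is covered by the outside of [s] and the outside of [F]. *)
  have [s fsn] := fs (\max_(a <- F) N a)%N.
  apply: nP; apply: osc_leS (osc_leU fsn fF) => a Pa.
  have [aF|?] := boolP (a \in F); last by right.
  left; split=> //= E; apply: (NP a Pa); apply: osc_leS fsn => b [Pb nb].
  split=> //= Eb; apply: nb; rewrite -E in Eb; apply: eq_patW Eb.
  exact: leq_bigmax_seq.
(* At a level separating [a] from [F'], the set [P \ a] is covered by its part outside the cell of
   [a] and the outside of [F']. *)
exists a => //; apply: osc_le_closed => d d0; have [F' fF'] := ff d d0.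
have [n nP'] := pat_separates C_sep (a :: F').
apply: osc_leS (osc_leU (fa n) fF') => b [Pb ba].
have [bF|?] := boolP (b \in F'); last by right.
left; split=> //= E; apply: ba; apply: nP' => //; first by rewrite inE bF orbT.
by rewrite inE eqxx.
Qed.

(** The dominating coordinate is unique by [concentrated_at]; without one the value is [a0]. *)
Definition osc_center (a0 : G) P e f : G :=
  xget a0 [set a | [/\ ~ osc_le f P (e + e), P a & osc_le f (P `\ a) e]].

Lemma osc_centerE a0 P e f a : ~ osc_le f P (e + e) -> P a -> osc_le f (P `\ a) e ->
  osc_center a0 P e f = a.
Proof.
move=> nP Pa fa; rewrite /osc_center.
case: xgetP => [b -> [_ Pb fb]|/(_ a) []//].
by apply/(concentrated_at [set x | x = a] nP fb).
Qed.

Lemma osc_center_preimage a0 P e f A : A (osc_center a0 P e f) <->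
  (concentrated f P e /\ osc_le f (P `\` A) e) \/ (~ concentrated f P e /\ A a0).
Proof.
have [[nP [a Pa fa]]|nc] := pselect (concentrated f P e).
  rewrite (osc_centerE a0 nP Pa fa); have H := concentrated_at A nP fa.
  split=> [/H fA|[[_ /H]//|[nc _]]].
    by left; split=> //; split=> //; exists a.
  by case: nc; split=> //; exists a.
rewrite /osc_center; case: xgetP => [b -> [nP Pb fb]|_].
  by case: nc; split=> //; eexists; [exact: Pb|exact: fb].
by split=> [?|[[]//|[]//]]; right.
Qed.

(* Coordinates of zero oscillation can be discarded one by one. *)
Lemma finitary_support f e : finitary f -> 0 < e -> exists F,
  osc_le f [set a | a \notin F] e /\ forall a, a \in F -> ~ osc_le f [set a] 0.
Proof.
move=> ff e0; have [F] := ff e e0.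
move: {2}(size F) (leqnn (size F)) => n.
elim: n F => [|n IH] F sF fF.
  by exists F; split=> // a; move: sF; rewrite leqn0 size_eq0 => /eqP ->.
have [FP|/existsNP[a /not_implyP[aF /contrapT fa]]] :=
    pselect (forall a, a \in F -> ~ osc_le f [set a] 0); first by exists F.
apply: (IH [seq b <- F | b != a]).
  rewrite -ltnS; apply: leq_trans sF; rewrite -(count_predC (pred1 a) F) size_filter.
  by rewrite -add1n leq_add2r -has_count; apply/hasP; exists a => //=.
rewrite -[e]addr0; apply: osc_leS (osc_leU fF fa) => b /=.
rewrite mem_filter negb_and negbK => /orP[/eqP ->|?]; [by right|by left].
Qed.

End Oscillation.

(** * Measurable selection of coordinates *)

Section OpenSets.
Context (R : realType) (G : choiceType) (T : Type) (S : set (set T)).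
Context (ev : T -> (G -> bool) -> R).
Hypothesis sS : sigma_algebra setT S.
Hypothesis ev_finitary : forall t, finitary (ev t).
Hypothesis ev_sub : forall x y (e : R), S [set t | `|ev t x - ev t y| <= e].
Hypothesis ev_cst : forall x (c e : R), S [set t | `|ev t x - c| <= e].

Hypothesis kG : kunen_cardinal G.
Hypothesis Ginf : exists h : G * G -> G, injective h.
Context (a0 : G) (C : nat -> G -> bool).
Hypothesis C_sep : forall a b, (forall k, C k a = C k b) -> a = b.

Lemma sigma_osc_le (A : set G) (e : R) : S [set t | osc_le (ev t) A e].
Proof.
rewrite (_ : [set t | _] = \bigcap_(i : _ * _) \bigcap_(j : _ * _)
  [set t | `|ev t (dense_pt C i) - ev t (fun a =>
     if pselect (A a) then dense_pt C j a else dense_pt C i a)| <= e]).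
  by apply: (sigma_bigcap sS) => i; apply: (sigma_bigcap sS) => j; exact: ev_sub.
apply/seteqP; split=> t.
  by move=> /(osc_le_dense C_sep _ _ (ev_finitary t)) H i _ j _; exact: H.
by move=> H; apply/(osc_le_dense C_sep _ _ (ev_finitary t)) => i j; exact: H.
Qed.

Lemma sigma_concentrated (P : set G) (e : R) : 0 < e -> S [set t | concentrated (ev t) P e].
Proof.
move=> e0; rewrite (_ : [set t | _] = ~` [set t | osc_le (ev t) P (e + e)] `&`
  \bigcap_n \bigcup_s [set t | osc_le (ev t) (P `&` [set a | pat C n a <> s]) e]).
  apply: (sigma_setI sS); first by apply: (sigma_setC sS); exact: sigma_osc_le.
  apply: (sigma_bigcap sS) => n; apply: (sigma_bigcup sS) => s; exact: sigma_osc_le.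
apply/seteqP; split=> t.
  move=> /(concentratedP C_sep _ (ev_finitary t) e0)[nP H]; split=> // n _.
  by have [s] := H n; exists s.
move=> [nP H]; apply/(concentratedP C_sep _ (ev_finitary t) e0); split=> // n.
by have [s _] := H n I; exists s.
Qed.

Lemma sigma_center (P : set G) (e : R) : 0 < e ->
  sigma_map S (fun t => osc_center a0 P e (ev t)).
Proof.
move=> e0 A; rewrite (_ : _ @^-1` A =
  ([set t | concentrated (ev t) P e] `&` [set t | osc_le (ev t) (P `\` A) e]) `|`
  (~` [set t | concentrated (ev t) P e] `&` [set t | A a0])).
  have := sigma_concentrated P e0 => Sc.
  apply: (sigma_setU sS); apply: (sigma_setI sS) => //.
  - exact: sigma_osc_le.
  - exact: (sigma_setC sS).
  - exact: (sigma_cst sS).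
by apply/seteqP; split=> t ?; exact/osc_center_preimage.
Qed.

Let step n : R := n.+1%:R^-1.

(** One candidate for an essential coordinate from each cell [p]. Each candidate depends measurably
    on [t], and the pairs of [ps] and [q] are countably many. *)
Let centers (ps : seq bitseq) q t : seq G :=
  [seq osc_center a0 [set a | pat C (size p) a = p] (step q) (ev t) | p <- ps].

(** A rational-valued function of bit strings, stored as a list at the positions [pickle bs], so
    that tables form a countable type. *)
Let table (l : seq rat) (bs : bitseq) : R := ratr (nth 0 l (pickle bs)).

(** The function nearly depends on a finite set [F] of coordinates of positive oscillation. For
    large [q] and a fine enough level each of them dominates its cell, so [centers] returns exactly
    [F]. *)
Lemma finitary_approx t (e : R) : 0 < e -> exists ps q l, forall x : G -> bool,
  `|ev t x - table l [seq x a | a <- centers ps q t]| <= e.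
Proof.
move=> e0; have e20 : 0 < e / 2 by rewrite divr_gt0.
have [F [fF Fsupp]] := finitary_support (ev_finitary t) e20.
have /choice[N NP] : forall a, exists q, a \in F ->
    ~ osc_le (ev t) [set a] (step q + step q).
  move=> a; have [aF|naF] := boolP (a \in F); last by exists 0%N.
  have /existsNP[x /existsNP[y /not_implyP[xy /negP]]] := Fsupp a aF.
  rewrite -ltNge => d0; have /ltr_add_invr[q qP] : 0 < `|ev t x - ev t y| / 2.
    by rewrite divr_gt0.
  exists q => _ /(_ x y xy) /=; apply/negP; rewrite -ltNge.
  by rewrite -mulr2n -mulr_natr -ltr_pdivlMr //; rewrite add0r in qP.
pose q := (\max_(a <- F) N a)%N.
have qP a : a \in F -> ~ osc_le (ev t) [set a] (step q + step q).
  move=> aF fa; apply: (NP a aF) => x y xy; apply: (le_trans (fa x y xy)).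
  suff H : step q <= step (N a) by exact: lerD.
  rewrite /step lef_pV2 ?posrE ?ltr0Sn // ler_nat ltnS.
  exact: leq_bigmax_seq.
have q0 : 0 < step q by rewrite invr_gt0.
(* Outside [F'] the oscillation is at most [step q]; a level that separates [F] and [F'] together
   leaves one relevant coordinate in each cell of [F]. *)
have [F' fF'] := ev_finitary t q0.
have [n nP] := pat_separates C_sep (F ++ F').
pose ps := [seq pat C n a | a <- F].
have csE : centers ps q t = F.
  rewrite /centers /ps -map_comp -[RHS]map_id; apply/eq_in_map => a aF /=.
  rewrite size_mkseq; apply: osc_centerE => //.
    by move=> H; apply: (qP a aF); apply: osc_leS H => b /= ->.
  apply: osc_leS fF' => b [/= ab ba]; apply/negP => bF'; apply: ba.
  by apply: nP => //; rewrite mem_cat ?aF ?bF' ?orbT.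
pose v bs := ev t (fun a => nth false bs (index a F)).
have /choice[r rP] : forall bs, exists r : rat, `|v bs - ratr r| <= e / 2.
  move=> bs; have /rat_in_itvoo[r] : v bs - e / 2 < v bs + e / 2.
    by rewrite ltrD2l gtrN.
  rewrite in_itv /= => /andP[r1 r2]; exists r.
  by rewrite ler_distlC ltW //= ltW.
(* [M] exceeds the codes of all bit strings of length [size F], so the list holds every value that
   is read. *)
pose M := (\max_(s : (size F).-tuple bool) pickle (val s)).+1%N.
exists ps, q, (mkseq (fun k => oapp r 0 (unpickle k)) M) => x.
rewrite csE; set bs := [seq x a | a <- F].
have sbs : size bs == size F by rewrite size_map.
rewrite /table nth_mkseq; last first.
  by rewrite ltnS; apply: (@leq_bigmax _ (fun s : _.-tuple _ => pickle (val s)) (Tuple sbs)).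
rewrite pickleK /= -(subrKA (v bs)).
rewrite (le_trans (ler_normD _ _)) // [e in X in _ <= X]splitr lerD //.
apply: osc_le_agree fF _ => a aF.
by rewrite (nth_map a) ?index_mem // nth_index.
Qed.

(** [U] is a countable union over [q], [n], [ps], [l] of two requirements: the table on the centers
    of [t] is within [step n] of [t], and everything within [step n] of that table lies in [U]. The
    latter is an arbitrary condition on the tuple of centers, which is where the Kunen property
    enters. *)
Lemma sigma_norm_open (U : set T) :
  (forall t, U t -> exists2 e : R, 0 < e &
     forall t', (forall x, `|ev t' x - ev t x| <= e) -> U t') -> S U.
Proof.
move=> Uo; pose X n (l : seq rat) : set (seq G) := [set s | forall t',
  (forall x, `|ev t' x - table l [seq x a | a <- s]| <= step n) -> U t'].
rewrite (_ : U = \bigcup_(i : nat * nat) \bigcup_(j : seq bitseq * seq rat)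
   ([set t | X i.2 j.2 (centers j.1 i.1 t)] `&`
    \bigcap_(d : nat * seq bitseq) \bigcup_(bs : bitseq)
      ([set t | [seq dense_pt C d a | a <- centers j.1 i.1 t] = bs] `&`
       [set t | `|ev t (dense_pt C d) - table j.2 bs| <= step i.2]))).
  have q0 q : 0 < step q by rewrite invr_gt0.
  have mc q p := sigma_center [set a | pat C (size p) a = p] (q0 q).
  apply: (sigma_bigcup sS) => -[q n]; apply: (sigma_bigcup sS) => -[ps l] /=.
  apply: (sigma_setI sS); first exact: (sigma_map_seq kG sS Ginf a0 ps (mc q) (X n l)).
  (* Fixing the bits [bs] read at the centers turns the table value into a constant, to which the
     evaluation is compared. *)
  apply: (sigma_bigcap sS) => d; apply: (sigma_bigcup sS) => bs.
  apply: (sigma_setI sS); last exact: ev_cst.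
  exact: (sigma_map_seq kG sS Ginf a0 ps (mc q) [set s | map (dense_pt C d) s = bs]).
apply/seteqP; split=> [t Ut|t [[q n] _ [[ps l] _ [/= Xt H]]]]; last first.
  (* Closeness at dense points passes to every [x], through a dense point that agrees with [x] on
     the centers and on a finite set nearly determining the value. *)
  apply: Xt => x; apply/ler_addgt0Pr => d d0; have [F fF] := ev_finitary t d0.
  have [i iP] := dense_ptP C_sep (F ++ centers ps q t) x.
  have [_ _ [<- /= Hi]] := H i I.
  rewrite -(subrKA (ev t (dense_pt C i))) addrC (le_trans (ler_normD _ _)) // lerD //.
    rewrite (_ : [seq x a | a <- _] = [seq dense_pt C i a | a <- centers ps q t]) //.
    by apply/eq_in_map => a aF; rewrite iP // mem_cat aF orbT.
  by apply: osc_le_agree fF _ => a aF; rewrite iP // mem_cat aF.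
have [e e0 Ue] := Uo t Ut.
have /ltr_add_invr[n nP] : 0 < e / 2 by rewrite divr_gt0.
rewrite add0r in nP.
have [ps [q [l tP]]] := @finitary_approx t (step n) ltac:(by rewrite invr_gt0).
exists (q, n) => //; exists (ps, l) => //; split=> /= [t' t'P|d _].
  apply: Ue => x; rewrite -(subrKA (table l [seq x a | a <- centers ps q t])).
  rewrite (le_trans (ler_normD _ _)) // [e]splitr lerD //.
    by rewrite (le_trans (t'P x)) // ltW.
  by rewrite distrC (le_trans (tP x)) // ltW.
exists [seq dense_pt C d a | a <- centers ps q t] => //; split=> //=; exact: tP.
Qed.

End OpenSets.

(** * Continuous functions on the Cantor cube *)

Section Pointwise.

Lemma cvg_ptws (I : Type) (Y : topologicalType) (F : set_system {ptws I -> Y})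
    (f : {ptws I -> Y}) : Filter F ->
  (forall i, (fun g : {ptws I -> Y} => g i) @ F --> f i) -> F --> f.
Proof.
move=> FF Ff; apply/cvg_sup => i U [V [[W oW <-] Wf] VU].
apply: (filterS VU); apply: Ff; exact: open_nbhs_nbhs.
Qed.

Lemma nbhs_ptws (I : eqType) (Y : topologicalType) (x : {ptws I -> Y}) U :
  nbhs x U -> exists F : seq I, forall y : I -> Y,
    (forall i, i \in F -> y i = x i) -> U y.
Proof.
pose cyl (F : seq I) := [set y : {ptws I -> Y} | forall i, i \in F -> y i = x i].
have FF : Filter (filter_from [set: seq I] cyl).
  apply: filter_from_filter; first by exists [::].
  move=> F F' _ _; exists (F ++ F') => // y yx.
  by split=> i iF; apply: yx; rewrite mem_cat iF ?orbT.
have cx : filter_from [set: seq I] cyl --> x.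
  apply: cvg_ptws => i W /nbhs_singleton Wx.
  by exists [:: i] => // y /= yx; rewrite /= yx // inE.
by move=> /cx [F _ FU]; exists F.
Qed.

End Pointwise.

Section CantorCube.
Context (G : choiceType).
Local Notation K := (cantor_cube G).

Lemma cube_compact : compact [set: K].
Proof.
have := @tychonoff G (fun=> bool) (fun=> setT) (fun=> bool_compact).
by rewrite (_ : [set f | _] = setT) //; apply/seteqP; split.
Qed.

Lemma cube_clopen a (b : bool) : clopen [set x : K | x a = b].
Proof.
apply: (@preimage_clopen K bool (@proj G (fun=> bool) a) [set b]).
  by split; [exact: discrete_open|exact: discrete_closed].
exact: proj_continuous.
Qed.

Context (R : realType).

(** Compactness, in its near-covering form, along the filter of finite sets of coordinates directed
    by inclusion. *)
Lemma continuous_finitary (f : K -> R) : continuous f -> finitary f.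
Proof.
move=> fc e e0.
pose Fs := filter_from [set: seq G] (fun F0 => [set F : seq G | {subset F0 <= F}]).
have FF : Filter Fs.
  apply: filter_from_filter; first by exists [::].
  move=> F F' _ _; exists (F ++ F') => // F2 sub.
  by split=> i iF; apply: sub; rewrite mem_cat iF ?orbT.
have e20 : 0 < e / 2 by rewrite divr_gt0.
have /compact_near_coveringP nc := cube_compact.
have [|F _ FP] := nc _ Fs (fun F x => forall y : K,
    (forall a, a \in F -> x a = y a) -> `|f x - f y| <= e) FF.
  move=> x _; have : nbhs x (f @^-1` ball (f x) (e / 2)) by apply: fc; exact: nbhsx_ballx.
  move=> /nbhs_ptws[F0 F0P].
  exists ([set y : K | forall a, a \in F0 -> y a = x a], [set F | {subset F0 <= F}]).
    split=> /=; last by exists F0.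
    elim: F0 {F0P} => [|a F0 IH]; first exact: filterS filterT.
    have [oa _] := cube_clopen a (x a).
    have : nbhs x [set y : K | y a = x a] by apply: open_nbhs_nbhs; split.
    move=> /filterI/(_ IH); apply: filterS => y [ya yF] b.
    by rewrite inE => /orP[/eqP ->//|/yF].
  move=> [x' F] /= [x'x F0F] y x'y.
  have := F0P x' x'x; have : ball (f x) (e / 2) (f y).
    by apply: F0P => a aF; rewrite -x'y ?x'x //; exact: F0F.
  rewrite /ball /= => H1 H2; rewrite -(subrKA (f x)) (splitr e).
  by rewrite (le_trans (ler_normD _ _)) // lerD // ltW // distrC.
exists F => x y xy; apply: (FP F) => // a aF.
by apply: xy => /=; rewrite aF.
Qed.

Lemma sup_norm_ub (f : K -> R) x : continuous f -> `|f x| <= sup_norm f.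
Proof.
move=> fc; apply: ub_le_sup; last by exists x.
have /compact_bounded[M [_ MP]] : compact (f @` [set: K]).
  apply: continuous_compact; last exact: cube_compact.
  exact: continuous_subspaceT.
exists (M + 1) => _ [y _ <-]; apply: (MP (M + 1)); first by rewrite ltrDl.
by exists y.
Qed.

Lemma sup_norm_le (f : K -> R) e : (forall x, `|f x| <= e) -> sup_norm f <= e.
Proof.
move=> fe; apply: ge_sup; first by exists `|f (fun=> false)|, (fun=> false).
by move=> _ [x _ <-].
Qed.

Lemma continuous_sub (f g : continuousType K R) : continuous (fun x => g x - f x).
Proof. by move=> x; apply: cvgB; exact: cts_fun. Qed.

Local Notation CK := (continuousType K R).

Lemma eval_continuous (x : K) : continuous (fun f : C_ptws R K => (f : CK) x : R).
Proof.
move=> f; apply: (@continuous_comp (C_ptws R K) {ptws K -> R} R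
  (fun f : CK => (f : K -> R)) (@proj K (fun=> R) x)).
  exact: initial_continuous.
exact: proj_continuous.
Qed.

Lemma baire_continuous (phi : CK -> R) (B : set R) :
  continuous (phi : C_ptws R K -> R) -> measurable B ->
  baire_algebra R (C_ptws R K) (phi @^-1` B).
Proof.
move=> pc mB; apply: sub_sigma_algebra; exists phi => //; exists B => //.
Qed.

Lemma baire_sub x y (e : R) :
  baire_algebra R (C_ptws R K) [set f : CK | `|f x - f y| <= e].
Proof.
rewrite (_ : [set f : CK | _] = (fun f : CK => f x - f y) @^-1` `[- e, e]).
  apply: baire_continuous; last exact: measurable_itv.
  move=> f; apply: (@cvgB _ _ (C_ptws R K) (nbhs f) _ (fun g : CK => g x) (fun g : CK => g y)).
    exact: (@eval_continuous x f).
  exact: (@eval_continuous y f).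
by apply/seteqP; split=> f; rewrite /= in_itv /= ler_norml.
Qed.

Lemma baire_cst x (c e : R) :
  baire_algebra R (C_ptws R K) [set f : CK | `|f x - c| <= e].
Proof.
rewrite (_ : [set f : CK | _] = (fun f : CK => f x - c) @^-1` `[- e, e]).
  apply: baire_continuous; last exact: measurable_itv.
  move=> f; apply: (@cvgB _ _ (C_ptws R K) (nbhs f) _ (fun g : CK => g x) (fun=> c)).
    exact: (@eval_continuous x f).
  exact: cvg_cst.
by apply/seteqP; split=> f; rewrite /= in_itv /= ler_norml.
Qed.

Lemma C_norm_openE (U : set (C_norm R K)) : open U = norm_open U.
Proof. by []. Qed.

Lemma norm_open_ptws (U : set CK) :
  open (U : set (C_ptws R K)) -> open (U : set (C_norm R K)).
Proof.
move=> [V oV <-]; rewrite C_norm_openE => f /= Vf.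
pose Fs := filter_from [set e : R | 0 < e]
  (fun e => [set g : {ptws K -> R} | forall x, `|g x - f x| <= e]).
have FF : Filter Fs.
  apply: filter_from_filter; first by exists 1; exact: ltr01.
  move=> d e d0 e0; exists (Num.min d e); first by rewrite /= lt_min d0.
  by move=> g gf; split=> x; have := gf x; rewrite le_min => /andP[].
have : Fs --> (f : {ptws K -> R}).
  apply: cvg_ptws => x W /nbhs_ballP[e /= e0 eW]; exists (e / 2).
    by rewrite /= divr_gt0.
  move=> g gf; apply: eW; rewrite /ball /= distrC; apply: le_lt_trans (gf x) _.
  by rewrite ltr_pdivrMr // ltr_pMr // ltr1n.
move=> /(_ V) []; first by apply: open_nbhs_nbhs.
move=> e e0 eV; exists e => // g gf; apply: eV => x.
apply: le_trans (ltW gf).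
exact: (@sup_norm_ub _ x (@continuous_sub f g)).
Qed.

Lemma measurable_rays (S : set (set R)) : sigma_algebra setT S ->
  (forall x, S `]-oo, x[%classic) -> (@measurable _ R : set (set R)) `<=` S.
Proof.
move=> sS Sr; rewrite [X in X `<=` _](@measurable_realfun.RGenInftyO.measurableE R).
by apply: smallest_sub => // _ [x ->].
Qed.

Lemma baire_borel :
  (baire_algebra R (C_ptws R K) : set (set CK)) `<=` borel_algebra (C_norm R K).
Proof.
apply: smallest_sub; first exact: smallest_sigma_algebra.
move=> _ [phi pc [B mB <-]].
suff : (@measurable _ R : set (set R)) `<=` [set B | borel_algebra (C_norm R K) (phi @^-1` B)].
  exact.
apply: measurable_rays.
  have [B0 BC BU] := smallest_sigma_algebra setT (@open (C_norm R K)).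
  split.
  - by rewrite /= preimage_set0.
  - by move=> A /BC; rewrite /= !setTD preimage_setC.
  - by move=> A /BU; rewrite /= preimage_bigcup.
move=> x /=; apply: sub_sigma_algebra; apply: norm_open_ptws.
by apply: open_comp => //; exact: interval_open.
Qed.

Lemma kunen_baire_borel : infinite_set [set: G] -> kunen_cardinal G ->
  baire_algebra R (C_ptws R K) = borel_algebra (C_norm R K) :> set (set CK).
Proof.
move=> Ginf kG; apply/seteqP; split; first exact: baire_borel.
have [C C_sep] := kunen_separating kG.
have [a0 _] : [set: G] !=set0.
  by apply/set0P/eqP => G0; apply: Ginf; rewrite G0.
apply: smallest_sub; first exact: smallest_sigma_algebra.
move=> U; rewrite C_norm_openE => Uo; have sB : sigma_algebra setT (baire_algebra R (C_ptws R K)).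
  exact: smallest_sigma_algebra.
have fin (f : CK) : finitary f by apply: continuous_finitary; exact: cts_fun.
apply: (sigma_norm_open sB fin baire_sub baire_cst kG (infinite_pairing Ginf) a0 C_sep).
move=> f Uf; have [e e0 eU] := Uo f Uf; exists (e / 2); first by rewrite divr_gt0.
move=> g gf; apply: eU; apply: (le_lt_trans (sup_norm_le gf)).
by rewrite ltr_pdivrMr // ltr_pMr // ltr1n.
Qed.

Lemma open_ball_union (A : set CK) (r : R) :
  open (\bigcup_(f in A) [set g : C_norm R K | sup_norm (fun x => g x - f x) < r]).
Proof.
rewrite C_norm_openE => g [f Af /= gf]; exists (r - sup_norm (fun x => g x - f x)).
  by rewrite subr_gt0.
move=> h; rewrite ltrBrDr => hg; exists f => //=; apply: le_lt_trans hg.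
apply: sup_norm_le => x; rewrite -(subrKA (g x)) (le_trans (ler_normD _ _)) // lerD //.
  exact: (@sup_norm_ub _ x (@continuous_sub g h)).
exact: (@sup_norm_ub _ x (@continuous_sub f g)).
Qed.

Lemma baire_two :
  baire_algebra R (C_ptws R K) = borel_algebra (C_norm R K) :> set (set CK) ->
  [set C_two R K `&` A | A in baire_algebra R (C_ptws R K)] =
  [set A | A `<=` C_two R K].
Proof.
move=> BB; apply/seteqP; split=> [_ [A _ <-]|A A2]; first by move=> f [].
(* Radius 1/2 is below the mutual distance 1 of two-valued functions, so each ball catches only its
   centre among them. *)
exists (\bigcup_(f in A) [set g : CK | sup_norm (fun x => g x - f x) < 1 / 2]).
  by rewrite BB; apply: sub_sigma_algebra; exact: open_ball_union.
apply/seteqP; split=> [g [g2 [f Af gf]]|f Af]; last first.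
  split; first exact: A2.
  exists f => //=; apply: (@le_lt_trans _ _ 0); last by rewrite divr_gt0.
  by apply: sup_norm_le => x; rewrite subrr normr0.
suff -> : g = f by [].
apply/continuousEP => x.
have := le_lt_trans (@sup_norm_ub _ x (@continuous_sub f g)) gf.
have not_half : (1 : R) < 1 / 2 -> False.
  by rewrite ltr_pdivlMr // mul1r (ltr_nat R 2 1).
case: (g2 x) (A2 _ Af x) => -> [] -> //.
  by rewrite sub0r normrN normr1 => /not_half.
by rewrite subr0 normr1 => /not_half.
Qed.

End CantorCube.

(** * Countable chain condition *)

Section Conditions.
Context (I : eqType).
Implicit Types (p q : seq (I * bool)) (c : set I).

(** A list of entries stands for a finite partial function to [bool], that is a basic open set of
    [2^I]; [conflict p p] means that [p] is inconsistent. *)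
Definition conflict p q : Prop := exists i b, (i, b) \in p /\ (i, ~~ b) \in q.

Definition satisfies c p : Prop := forall u, u \in p -> (c u.1 <-> u.2).

Lemma satisfies_consistent c p : satisfies c p -> ~ conflict p p.
Proof.
by move=> cp [i [[] [/cp /= + /cp /=]]] => -[A B] [A' B']; [apply/notF/A'/B|apply/notF/A/B'].
Qed.

(* Fix [p0] in [B]: a [p] conflicting with it contains one of the finitely many
   flipped entries of [p0]; drop that entry and use induction on the size. *)
Lemma finite_predense n (B : set (seq (I * bool))) :
  (forall p, B p -> (size p <= n)%N /\ ~ conflict p p) ->
  exists L : seq (seq (I * bool)), (forall q, q \in L -> B q) /\
    forall p, B p -> exists2 q, q \in L & ~ conflict p q.
Proof.
elim: n B => [|n IH] B Bn.
  have [[p0 Bp0]|nB] := pselect (B !=set0); last first.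
    by exists [::]; split=> // p Bp; case: nB; exists p.
  exists [:: p0]; split=> [q|p Bp]; first by rewrite inE => /eqP ->.
  exists p0; first by rewrite inE.
  by move=> [i [b [+ _]]]; have [] := Bn p Bp; rewrite leqn0 size_eq0 => /eqP ->.
have [[p0 Bp0]|nB] := pselect (B !=set0); last first.
  by exists [::]; split=> // p Bp; case: nB; exists p.
have /choice[L LP] : forall u : I * bool, exists L : seq (seq (I * bool)),
    (forall q, q \in L -> B q) /\
    forall p, B p -> u \in p -> exists2 q, q \in L & ~ conflict p q.
  move=> u; pose rest p := [seq v <- p | v != u].
  have [|L [LB LP]] := IH [set r | exists p, [/\ B p, u \in p & r = rest p]].
    move=> _ [p [Bp up ->]]; have [sp cp] := Bn p Bp; split.
      rewrite -ltnS; apply: leq_trans sp; rewrite -(count_predC (pred1 u) p) size_filter.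
      by rewrite -add1n leq_add2r -has_count; apply/hasP; exists u => //=.
    by move=> [i [b []]]; rewrite !mem_filter => /andP[_ ?] /andP[_ ?]; apply: cp; exists i, b.
  have /choice[l lP] : forall r, exists p, r \in L -> [/\ B p, u \in p & r = rest p].
    move=> r; have [rL|nrL] := boolP (r \in L); last by exists r.
    by have [p ?] := LB r rL; exists p.
  exists [seq l r | r <- L]; split=> [_ /mapP[r rL ->]|p Bp up]; first by case: (lP r rL).
  have [|r rL pr] := LP (rest p); first by exists p.
  exists (l r); first exact: map_f.
  have [Blr ulr rE] := lP r rL.
  (* A conflict between [p] and [l r] survives dropping [u]: at [u] one of the two would conflict
     with itself. *)
  move=> [i [b [ibp ibr]]]; apply: pr; exists i, b.
  rewrite rE !mem_filter ibp ibr !andbT; split; apply/eqP => E.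
    by have [_] := Bn _ Blr; apply; exists i, b; rewrite E ulr.
  by have [_] := Bn _ Bp; apply; exists i, b; rewrite ibp E up.
exists (p0 :: flatten [seq L (u.1, ~~ u.2) | u <- p0]); split=> [q|p Bp].
  by rewrite inE => /orP[/eqP ->//|/flattenP[_ /mapP[u _ ->]]]; exact: (LP _).1.
have [[i [b [ibp ibp0]]]|np] := pselect (conflict p p0); last first.
  by exists p0; rewrite ?inE ?eqxx.
have [q qL pq] := (LP (i, b)).2 p Bp ibp; exists q => //.
rewrite inE; apply/orP; right; apply/flattenP; exists (L (i, b)) => //.
by apply/mapP; exists (i, ~~ b); rewrite //= negbK.
Qed.

End Conditions.

Section Separation.
Context (I : choiceType) (i0 : I) (D : set (set I)) (S : set (set (set I))).
Hypothesis sS : sigma_algebra D S.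
Hypothesis S_eval : forall i, S (D `&` [set c | c i]).
Hypothesis D_dense : forall p : seq (I * bool), ~ conflict p p ->
  exists2 c, D c & satisfies c p.

Definition ptw_open (V : set (set I)) : Prop := forall c, D c -> V c ->
  exists F : seq I, forall c', D c' -> (forall i, i \in F -> (c' i <-> c i)) -> V c'.

Let sigma_satisfies p : S (D `&` [set c | satisfies c p]).
Proof.
case: sS => S0 SC SU.
rewrite (_ : D `&` _ = D `\` \bigcup_(k : 'I_(size p))
    let u := tnth (in_tuple p) k in
    if u.2 then D `\` (D `&` [set c | c u.1]) else D `&` [set c | c u.1]).
  apply: (SC); apply: (sigma_bigcup sS) => k /=.
  by case: (tnth _ _).2; [apply: SC|]; exact: S_eval.
apply/seteqP; split=> c [Dc cp]; split=> //.
  move=> [k _] /=; have := mem_tnth k (in_tuple p).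
  set u := tnth _ _ => /cp; case: u.2 => H; last by case=> _ /H.
  by case=> _; apply; split=> //; exact/H.
move=> u /seq_tnthP[k uE]; apply: contrapT => nc; apply: cp; exists k => //=.
rewrite (tnth_nth u) /= in uE *; rewrite -uE.
move: nc; case: u.2 => nc; last by split=> //; apply: contrapT => ?; apply: nc.
by split=> // -[_ cu]; apply: nc.
Qed.

(* A set of conditions contained in [V] and predense below [V] can be chosen
   countable (countable chain condition); membership in the closure of [V] then
   depends on the countably many coordinates it mentions. *)
Lemma ptw_open_separation V1 V2 : ptw_open V1 -> ptw_open V2 ->
  V1 `&` V2 = set0 -> exists2 W, S W & D `&` V1 `<=` W /\ W `<=` D `\` V2.
Proof.
move=> V1o V2o V120.
(* Conditions that force membership in [V1], sorted by size because [finite_predense] needs a bound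
   on it. *)
pose B n := [set p : seq (I * bool) | [/\ (size p <= n)%N, ~ conflict p p &
  forall c, D c -> satisfies c p -> V1 c]].
have /choice[L LP] n := @finite_predense _ n (B n) (fun p Bp => let: And3 x y _ := Bp in conj x y).
(* Three indices name each coordinate mentioned in some [L n], so the conditions [cond l] on these
   coordinates form a countable family. *)
pose coord (k : nat * nat * nat) : I :=
  (nth (i0, true) (nth [::] (L k.1.1) k.1.2) k.2).1.
pose cond (l : seq (nat * nat * nat * bool)) := [seq (coord u.1, u.2) | u <- l].
pose bad l := forall n q, q \in L n -> conflict (cond l) q.
exists (D `\` \bigcup_l ([set c | bad l] `&` (D `&` [set c | satisfies c (cond l)]))).
  case: (sS) => S0 SC SU; apply: (SC); apply: (sigma_bigcup sS) => l.
  have [bl|nbl] := pselect (bad l).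
    by rewrite (_ : [set c | bad l] = setT) ?setTI //; apply/seteqP; split.
  by rewrite (_ : [set c | bad l] = set0) ?set0I //; apply/seteqP; split.
split=> [c [Dc V1c]|c [Dc nbad]]; split=> //.
  (* Adding to [cond l] the bits of [c] on [F] gives a condition inside [V1]; some chosen [q] is
     compatible with it, against [bad l]. *)
  move=> [l _ [bl [_ cl]]]; have [F FV] := V1o c Dc V1c.
  pose r := cond l ++ [seq (i, `[<c i>]) | i <- F].
  have cr : satisfies c r.
    move=> u; rewrite mem_cat => /orP[/cl//|/mapP[i _ ->]] /=.
    by split=> /asboolP.
  have Br : B (size r) r.
    split=> //; first exact: satisfies_consistent cr.
    move=> c' Dc' c'r; apply: FV => // i iF.
    have /c'r /= : (i, `[<c i>]) \in r by rewrite mem_cat map_f ?orbT.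
    by move=> ->; split=> /asboolP.
  have [q qL nrq] := (LP (size r)).2 r Br.
  have [i [b [ib ibq]]] := bl _ _ qL; apply: nrq; exists i, b; split=> //.
  by rewrite mem_cat ib.
move=> V2c; have [F FV] := V2o c Dc V2c.
pose b2 := [seq (i, `[<c i>]) | i <- F].
have cb2 : satisfies c b2 by move=> u /mapP[i _ ->] /=; split=> /asboolP.
(* [cond l] keeps the entries of [b2] that can conflict with a chosen condition. A chosen [q]
   compatible with it is then compatible with [b2], and a point satisfying both lies in [V1] and
   [V2]. *)
have [l [lb2 ll]] : exists l, {subset cond l <= b2} /\
    forall i b n q, (i, b) \in b2 -> q \in L n -> (i, ~~ b) \in q -> (i, b) \in cond l.
  elim: (b2) => [|[i b] b' [l [lb ll]]]; first by exists [::].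
  have [[n [q [qL iq]]]|nn] := pselect (exists n q, q \in L n /\ (i, ~~ b) \in q).
    have ci : coord (n, index q (L n), index (i, ~~ b) q) = i.
      by rewrite /coord /= nth_index // nth_index.
    exists ((n, index q (L n), index (i, ~~ b) q, b) :: l); split=> [u|i' b'' n' q'].
      by rewrite /= ci !inE => /orP[->//|/lb ->]; rewrite orbT.
    rewrite /= ci !inE => /orP[->//|ib q'L iq'].
    by apply/orP; right; exact: ll ib q'L iq'.
  exists l; split=> [u /lb|i' b'' n' q']; first by rewrite inE orbC => ->.
  rewrite inE => /orP[/eqP[-> ->] q'L iq'|]; last exact: ll.
  by case: nn; exists n', q'.
have : ~ bad l.
  move=> bl; apply: nbad; exists l => //; split=> //; split=> // u /lb2; exact: cb2.
move=> /existsNP[n /existsNP[q /not_implyP[qL nlq]]].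
have [_ qq qV1] := (LP n).1 q qL.
have nb2q : ~ conflict b2 q.
  by move=> [i [b [ib iq]]]; apply: nlq; exists i, b; split=> //; exact: (ll _ _ _ _ ib qL iq).
have [c' Dc' c'p] : exists2 c', D c' & satisfies c' (b2 ++ q).
  apply: D_dense => -[i [b []]]; rewrite !mem_cat => /orP[ib|ib] /orP[ib'|ib'].
  - by apply: (satisfies_consistent cb2); exists i, b.
  - by apply: nb2q; exists i, b.
  - by apply: nb2q; exists i, (~~ b); rewrite negbK.
  - by apply: qq; exists i, b.
have : (V1 `&` V2) c'; last by rewrite V120.
split; first by apply: qV1 => // u uq; apply: c'p; rewrite mem_cat uq orbT.
apply: FV => // i iF; have /c'p /= -> : (i, `[<c i>]) \in b2 ++ q by rewrite mem_cat map_f.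
by split=> /asboolP.
Qed.

End Separation.

(** * Clopen sets *)

Section Clopen.
Context (G : choiceType).
Local Notation K := (cantor_cube G).

Lemma clopen_separates (T F : seq K) : (forall t s, t \in T -> s \in F -> t <> s) ->
  exists c : set K, [/\ clopen c, forall t, t \in T -> c t & forall s, s \in F -> ~ c s].
Proof.
have one (t : K) (F' : seq K) : (forall s, s \in F' -> t <> s) ->
    exists c : set K, [/\ clopen c, c t & forall s, s \in F' -> ~ c s].
  elim: F' => [|s F' IH] tF; first by exists setT; split=> //; exact: clopenT.
  have [|c [cc ct cF]] := IH; first by move=> u uF; apply: tF; rewrite inE uF orbT.
  have /existsNP[a sta] : ~ forall a, s a = t a.
    by move=> /funext E; apply: (tF s); rewrite ?inE ?eqxx.
  exists (c `&` [set x | x a = t a]); split=> //.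
    by apply: clopenI => //; exact: cube_clopen.
  by move=> u; rewrite inE => /orP[/eqP -> [_ /sta]|/cF nc [/nc]].
elim: T => [|t T IH] TF; first by exists set0; split=> [|t|s _ []] //; exact: clopen0.
have [|c [cc cT cF]] := IH; first by move=> u s uT; apply: TF; rewrite inE uT orbT.
have [|d [dc dt dF]] := one t F; first by move=> s; apply: TF; rewrite inE eqxx.
exists (c `|` d); split; first exact: clopenU.
  by move=> u; rewrite inE => /orP[/eqP ->|/cT]; [right|left].
by move=> s sF [/(cF _ sF)|/(dF _ sF)].
Qed.

(** Clopen sets are dense in the power set of [K], as they separate disjoint finite sets of
    points. *)
Lemma clopen_dense (p : seq (K * bool)) : ~ conflict p p ->
  exists2 c, @clopen K c & satisfies c p.
Proof.
move=> np; pose side b := [seq u.1 | u <- p & u.2 == b].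
have sideP b t : t \in side b -> (t, b) \in p.
  by move=> /mapP[[s b']]; rewrite mem_filter => /= /andP[/eqP -> ?] ->.
have [|c [cc cT cF]] := @clopen_separates (side true) (side false).
  move=> t s /sideP tp /sideP sp ts; apply: np; exists t, true; split=> //.
  by rewrite ts.
exists c => // -[t []] /= tp; split=> //.
  by move=> _; apply: cT; apply/mapP; exists (t, true); rewrite // mem_filter.
by move=> ct; case: (cF t) => //; apply/mapP; exists (t, false); rewrite // mem_filter.
Qed.

Lemma point_ultrafilter (t : K) :
  ba_ultrafilter (@clopen K) (@clopen K `&` [set c | c t]).
Proof.
split.
  split.
  - by move=> c [].
  - by split; [exact: clopenT|].
  - by move=> [].
  - by move=> P Q [cP Pt] [cQ Qt]; split=> //; exact: clopenI.
  - by move=> P Q [cP Pt] cQ PQ; split=> //; exact: PQ.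
move=> F' [F'c _ F'0 F'I _] sub; apply/seteqP; split=> // P F'P.
split; first exact: F'c.
apply: contrapT => nPt; apply: F'0; rewrite -(setICr P); apply: F'I => //.
by apply: sub; split=> //; apply: (@clopenC _ P P); exact: F'c.
Qed.

Local Notation ultra := (<<s @clopen K, [set U | ba_ultrafilter (@clopen K) U] >>).

Context (R : realType).
Local Notation CK := (continuousType K R).

Lemma indicator_continuous (c : set K) : clopen c ->
  continuous (fun x => (`[< c x >]%:R : R)).
Proof.
move=> [oc cc] x; apply: cvg_near_cst.
have [cx|ncx] := pselect (c x).
  have : nbhs x c by apply: open_nbhs_nbhs.
  by apply: filterS => y cy; rewrite !asboolT.
have : nbhs x (~` c) by apply: open_nbhs_nbhs; split=> //; exact: closed_openC.
by apply: filterS => y cy; rewrite !asboolF.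
Qed.

Section Embedding.
Context (j : set K -> CK).
Hypothesis jE : forall c, clopen c -> forall x, j c x = `[< c x >]%:R.

Lemma preimage_ptw_open (O : set CK) : open (O : set (C_ptws R K)) ->
  ptw_open (@clopen K) (j @^-1` O).
Proof.
move=> [V oV <-] c cc Vc; have : nbhs (j c : {ptws K -> R}) V.
  by apply: open_nbhs_nbhs; split.
move=> /nbhs_ptws[F FV]; exists F => c' cc' c'c; apply: FV => x xF.
by rewrite !jE //; congr (_%:R); congr (nat_of_bool _); apply: asbool_equiv_eq; exact: c'c.
Qed.

(** Rays suffice. For continuous [phi], the open sets where [phi] is below and above
    [x - n.+1%:R^-1] are disjoint; the sets [W n] separating them exhaust the preimage of the ray
    below [x]. *)
Lemma baire_preimage_ultra (B : set CK) : baire_algebra R (C_ptws R K) B ->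
  ultra (@clopen K `&` j @^-1` B).
Proof.
have sU := smallest_sigma_algebra (@clopen K) [set U | ba_ultrafilter (@clopen K) U].
have sP X (h : set K -> X) : sigma_algebra setT [set B | ultra (@clopen K `&` h @^-1` B)].
  case: (sU) => U0 UC UU; split.
  - by rewrite /= preimage_set0 setI0.
  - move=> A /UC; rewrite /= setTD; congr (ultra _).
    apply/seteqP; split=> c [cc nA]; split=> //; first by move=> Ac; apply: nA.
    by move=> [_ /nA].
  - by move=> A /UU; rewrite /= preimage_bigcup setI_bigcupr.
move: B; apply: smallest_sub; first exact: sP.
move=> _ [phi pc [B mB <-]].
suff : (@measurable _ R : set (set R)) `<=` [set B | ultra (@clopen K `&` (phi \o j) @^-1` B)].
  exact.
apply: measurable_rays => [|x] /=; first exact: sP.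
have {}pc (A : set R) : open A -> open (phi @^-1` A : set (C_ptws R K)).
  by move=> oA; apply: open_comp.
have /choice[W WP] : forall n, exists W, ultra W /\
    @clopen K `&` (j @^-1` (phi @^-1` `]-oo, x - n.+1%:R^-1[%classic)) `<=` W /\
    W `<=` @clopen K `\` (j @^-1` (phi @^-1` `]x - n.+1%:R^-1, +oo[%classic)).
  move=> n; have [||||W] := @ptw_open_separation K (fun=> false) _ _ sU _ clopen_dense
      (j @^-1` (phi @^-1` `]-oo, x - n.+1%:R^-1[%classic))
      (j @^-1` (phi @^-1` `]x - n.+1%:R^-1, +oo[%classic)).
  - by move=> t; apply: sub_sigma_algebra; exact: point_ultrafilter.
  - by apply: preimage_ptw_open; apply: pc; exact: interval_open.
  - by apply: preimage_ptw_open; apply: pc; exact: interval_open.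
  - apply/seteqP; split=> // c [] /=; rewrite !in_itv /= andbT => /lt_trans H /H.
    by rewrite ltxx.
  - by move=> ? ?; exists W.
rewrite (_ : _ `&` _ = \bigcup_n W n).
  by apply: (sigma_bigcup sU) => n; case: (WP n).
apply/seteqP; split=> c.
  move=> [cc] /=; rewrite in_itv /= => cx.
  have /ltr_add_invr[n nP] := cx.
  exists n => //; apply: (WP n).2.1; split=> //=.
  by rewrite in_itv /= ltrBrDr.
move=> [n _ /(WP n).2.2 [cc]] /=; rewrite !in_itv /= andbT => /negP.
rewrite -leNgt => H; split=> //; apply: (le_lt_trans H).
by rewrite ltrBlDr ltrDl invr_gt0.
Qed.

End Embedding.

(** Indicators identify clopen sets with two-valued functions, so any family of clopen sets is the
    preimage of a Baire set. *)
Lemma two_ultra :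
  [set C_two R K `&` A | A in baire_algebra R (C_ptws R K)] =
    [set A | A `<=` C_two R K] ->
  ultra = [set P | P `<=` @clopen K].
Proof.
move=> two; have sU := smallest_sigma_algebra (@clopen K) [set U | ba_ultrafilter (@clopen K) U].
apply/seteqP; split.
  apply: smallest_sub; last by move=> U [[]].
  split=> //; first by move=> A _ c [].
  by move=> A Ac c [n _ /Ac].
have /choice[j jE] : forall c : set K, exists f : CK,
    clopen c -> forall x, f x = `[< c x >]%:R.
  move=> c; have [cc|ncc] := pselect (clopen c).
    by exists (mkcts (indicator_continuous cc)).
  by exists (mkcts (@cst_continuous K R 0)).
move=> P Pc; have : [set A | A `<=` C_two R K] (j @` P).
  move=> _ [c /Pc cc <-] x; rewrite jE //.
  by case: asboolP => _; [right|left].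
rewrite -two => -[B mB BE].
rewrite (_ : P = @clopen K `&` j @^-1` B); first exact: baire_preimage_ultra.
apply/seteqP; split=> [c Pc'|c [cc Bc]].
  by split; [exact: Pc|have [] : (C_two R K `&` B) (j c) by rewrite BE; exists c].
have [d Pd jdc] : (j @` P) (j c).
  rewrite -BE; split=> // x; rewrite jE //.
  by case: asboolP => _; [right|left].
have E x : `[< c x >] = `[< d x >].
  have := congr1 (fun f : CK => f x) jdc; rewrite !jE //; last exact: Pc.
  by case: asbool; case: asbool => //= /eqP; rewrite eqr_nat.
suff -> : c = d by [].
by apply/seteqP; split=> x /asboolP; [rewrite E|rewrite -E] => /asboolP.
Qed.

Lemma ultra_kunen : ultra = [set P | P `<=` @clopen K] -> kunen_cardinal G.
Proof.
move=> UP; pose phi (p : G * G) : set K := [set x | x p.1 = true] `&` [set x | x p.2 = false].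
have phic p : clopen (phi p) by apply: clopenI; exact: cube_clopen.
apply/seteqP; split=> // X _.
set Q := <<s _ >>; have sQ : sigma_algebra setT Q by exact: smallest_sigma_algebra.
have QX A B : Q (A `*` B) by apply: sub_sigma_algebra; exists A => //; exists B.
have pull Z : Z `<=` @clopen K -> Q (phi @^-1` Z).
  move=> Zc; have : [set P | P `<=` @clopen K] Z by [].
  rewrite -UP; move: Z {Zc}; apply: smallest_sub.
    case: (sQ) => Q0 QC QU; split.
    - by rewrite /= preimage_set0.
    - move=> A /QC; rewrite /= setTD; congr (Q _).
      by apply/seteqP; split=> p //= -[].
    - by move=> A /QU; rewrite /= preimage_bigcup.
  move=> U [[Uc _ _ UI Uup] _] /=.
  (* A filter contains the intersection of two clopen sets exactly when it contains both, hence the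
     rectangle. *)
  rewrite (_ : phi @^-1` U = [set a | U [set x | x a = true]] `*` [set b | U [set x | x b = false]]) //.
  apply/seteqP; split=> -[a b] /=; last by move=> [Ua Ub]; exact: UI.
  move=> Uab; split; apply: Uup Uab _ _; try exact: cube_clopen.
    by move=> x [].
  by move=> x [].
(* The point supported at [a] and the point vanishing only at [b] both lie in [phi (a, b)]; they
   show that it is nonempty and recover [a] and [b] from it. *)
have phi_l a b : a <> b -> phi (a, b) (fun i => i == a).
  by move=> ab; split=> /=; [rewrite eqxx|apply/eqP => ba; apply: ab].
have phi_r a b : a <> b -> phi (a, b) (fun i => i != b).
  by move=> ab; split=> /=; [apply/eqP|rewrite eqxx].
pose off : set (G * G) := [set p | p.1 <> p.2].
have offE : off = phi @^-1` [set c | clopen c /\ c <> set0].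
  apply/seteqP; split=> -[a b] /=.
    move=> ab; split; first exact: phic.
    by move=> E; have := phi_l _ _ ab; rewrite E.
  rewrite /off /= => -[_ n0] ab; apply: n0; apply/seteqP; split=> // x [/= xa].
  by rewrite -ab xa.
have Qoff : Q off by rewrite offE; apply: pull => c [].
(* Off the diagonal, injectivity of [phi] makes [X] a preimage; on the diagonal, [X] is cut out by a
   rectangle. *)
rewrite (_ : X = (phi @^-1` (phi @` (X `&` off)) `&` off) `|`
    (~` off `&` ([set a | X (a, a)] `*` setT))).
  apply: (sigma_setU sQ); apply: (sigma_setI sQ) => //.
    by apply: pull => _ [p _ <-].
  exact: (sigma_setC sQ).
apply/seteqP; split=> [[a b] Xab|[a b]].
  have [ab|/contrapT ab] := pselect (a <> b).
    by left; split=> //; exists (a, b).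
  by right; split; [case|split=> //=; rewrite {2}ab].
move=> [[[[a' b'] [Xab' ab'] E] ab]|[/contrapT /= <- []//]].
have := phi_l _ _ ab'; rewrite E => -[/= /eqP -> _].
by have := phi_r _ _ ab'; rewrite E => -[_ /= /negbFE /eqP ->].
Qed.

End Clopen.

Theorem theorem2p8 (R : realType) (G : Type) (Ginf : infinite_set [set: G]) :
  [<-> kunen_cardinal G;

       baire_algebra R (C_ptws R (cantor_cube G))
       = borel_algebra (C_norm R (cantor_cube G))
       :> set (set (continuousType (cantor_cube G) R));

       [set C_two R (cantor_cube G) `&` A
         | A in baire_algebra R (C_ptws R (cantor_cube G))]
       = [set A | A `<=` C_two R (cantor_cube G)];

       <<s @clopen (cantor_cube G),
           [set U | ba_ultrafilter (@clopen (cantor_cube G)) U] >>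
       = [set P | P `<=` @clopen (cantor_cube G)]].
Proof.
tfae.
(* [{classic G}] equips the bare type [G] with decidable equality and choice. *)
- exact: (@kunen_baire_borel {classic G} R Ginf).
- exact: (@baire_two {classic G} R).
- exact: (@two_ultra {classic G} R).
- exact: (@ultra_kunen {classic G}).
Qed.
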